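(* Let $G = ([n],E)$ be an undirected graph. The elements of $\mathcal{A}_G^{(1)} \setminus \mathcal{A}_G^{(0)}$ are precisely the characteristic vectors $\mathbf{e}(C)$ of odd circuits $C$ in $G$.
   Context: Graphs are simple. $\mathbf{e}_i$ is the $i$th standard unit vector of $\mathbb{R}^n$ and, for a subgraph $H$ of $G$ with vertex set $V_H$, $\mathbf{e}(H) = \sum_{i \in V_H} \mathbf{e}_i$. A circuit in $G$ is a closed walk with distinct vertices and edges (not necessarily chordless); it is odd if it has an odd number of vertices. Let $$\mathcal{A}_G := \{\mathbf{e}_i + \mathbf{e}_j : \{i,j\} \in E\} \cup \{-\mathbf{e}_i : i \in [n]\}.$$ A basis in a set of vectors of $\mathbb{Z}^n$ is a subset of $n$ linearly independent vectors, and the cone generated by it is a basis cone. The minimal Hilbert basis of a pointed rational cone $K$ is the unique minimal finite set $H \subset K \cap \mathbb{Z}^n$ such that every element of $K \cap \mathbb{Z}^n$ is a nonnegative integer combination of elements of $H$. Set $\mathcal{A}_G^{(0)} = \mathcal{A}_G$, and for $k \geq 1$ let $\mathcal{A}_G^{(k)}$ be the union of the minimal Hilbert bases of all basis cones of $\mathcal{A}_G^{(k-1)}$. *)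

(* Defs.v *)
From mathcomp Require Import all_boot all_order all_algebra finmap.
From mathcomp Require Import classical_sets.

Set Implicit Arguments.
Unset Strict Implicit.
Unset Printing Implicit Defensive.

Import Order.TTheory GRing.Theory Num.Theory.
Local Open Scope ring_scope.
Local Open Scope classical_set_scope.

(* A simple graph on [n] is a symmetric irreflexive relation on 'I_n;
   integer vectors are rows. *)

Definition unit_vec (n : nat) (i : 'I_n) : 'rV[int]_n := delta_mx 0 i.

Definition char_vec (n : nat) (V : {set 'I_n}) : 'rV[int]_n :=
  \sum_(i in V) unit_vec i.

Definition walk_edges (n : nat) (c : seq 'I_n) : seq {set 'I_n} :=
  [seq [set x; next c x]%SET | x <- c].

(* A circuit is given by its cyclic sequence of vertices c. The condition on
   the edges excludes going back and forth along one edge. *)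
Definition circuit (n : nat) (e : rel 'I_n) (c : seq 'I_n) : bool :=
  [&& c != [::], cycle e c, uniq c & uniq (walk_edges c)].

Definition odd_circuit (n : nat) (e : rel 'I_n) (c : seq 'I_n) : bool :=
  circuit e c && odd (size c).

Definition circuit_vec (n : nat) (c : seq 'I_n) : 'rV[int]_n :=
  char_vec [set x in c]%SET.

Definition graph_vectors (n : nat) (e : rel 'I_n) : set 'rV[int]_n :=
  [set v | exists i j : 'I_n, e i j /\ v = unit_vec i + unit_vec j] `|`
  [set v | exists i : 'I_n, v = - unit_vec i].

Section Cones.
Variables (R : realFieldType) (n : nat).

Definition real_mx (m : nat) (B : 'M[int]_(m, n)) : 'M[R]_(m, n) :=
  map_mx intr B.

(* A basis in A is listed as the rows of a square matrix; linear independence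
   makes the rows distinct, and their order is irrelevant to the cone. *)
Definition basis_in (A : set 'rV[int]_n) (B : 'M[int]_n) : Prop :=
  (forall i, A (row i B)) /\ row_free (real_mx B).

Definition basis_cone (B : 'M[int]_n) : set 'rV[R]_n :=
  [set x | exists2 l : 'I_n -> R,
     forall i, 0 <= l i & x = \sum_i l i *: row i (real_mx B)].

Definition lattice_points (K : set 'rV[R]_n) : set 'rV[int]_n :=
  [set v | K (real_mx v)].

Definition hilbert_basis (K : set 'rV[R]_n) (H : {fset 'rV[int]_n}) : Prop :=
  (forall h, h \in H -> lattice_points K h) /\
  (forall v, lattice_points K v ->
     exists c : 'rV[int]_n -> nat, v = \sum_(h <- H) h *+ c h).

Definition min_hilbert_basis (K : set 'rV[R]_n) (H : {fset 'rV[int]_n}) :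
    Prop :=
  hilbert_basis K H /\
  (forall H' : {fset 'rV[int]_n},
     hilbert_basis K H' -> (H' `<=` H)%fset -> H' = H).

Definition hilbert_step (A : set 'rV[int]_n) : set 'rV[int]_n :=
  [set v | exists (B : 'M[int]_n) (H : {fset 'rV[int]_n}),
     [/\ basis_in A B, min_hilbert_basis (basis_cone B) H & v \in H]].

Definition iterated_vectors (e : rel 'I_n) (k : nat) : set 'rV[int]_n :=
  iter k hilbert_step (graph_vectors e).

End Cones.

(* Main.v *)
Require Import Defs.
From mathcomp Require Import fingroup perm boolp ring lra zify.
From mathcomp Require Import all_boot all_order all_algebra finmap.
From mathcomp Require Import classical_sets.

Set Implicit Arguments.
Unset Strict Implicit.
Unset Printing Implicit Defensive.

Import Order.TTheory GRing.Theory Num.Theory.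
Local Open Scope ring_scope.
Local Open Scope classical_set_scope.

(** The minimal Hilbert basis of a basis cone consists of the indecomposable
    elements of its monoid of lattice points: the nonzero ones that are not a
    sum of two nonzero ones ([min_hilbert_basis_coneP]). Every nonzero lattice
    point is a sum of indecomposable ones because a multiple of the sum of the
    coordinates is a positive integer-valued additive function, and there are
    finitely many of them because an indecomposable point that is not a
    generator has all its coordinates in [0, 1[. So [A^(1)] is the set of
    vectors that are indecomposable in some basis cone ([hilbert_stepP]).

    For an odd circuit [C], the edges of [C] and the vectors [- e_i], [i] not
    in [C], form a basis, in which [e(C)] has the coordinates 1/2 on the edges
    and 0 elsewhere. A lattice point that is a summand of [e(C)] in the cone has
    coordinates between 0 and 1/2 on the edges, and two consecutive ones have an
    integer sum; so they are all 0 or all 1/2, and [e(C)] is indecomposable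
    ([circuit_vec_indecomposable]). It is not in [A_G] since the sum of its
    entries is odd and positive.

    Conversely, let [v] be indecomposable in the cone of a basis [B] of [A_G],
    and not in [B]. Let [S] be the set of rows where [v] has a nonzero
    coordinate and [T] the set of the vertices on those rows. The coordinates
    lie in ]0, 1[ on [S] while [v] is integral, so every vertex of [T] is on at
    least two rows of [S]. A row contains at most two vertices, and a nonzero
    term in the expansion of [\det B] maps [S] injectively to [T]. Counting
    incidences in two ways turns all these inequalities into equalities: the
    rows of [S] are edges, they form a graph of degree two on [T], and the
    injection is a bijection ([fractional_rows_two_regular]). Going from each
    vertex [x] to the other end of the edge assigned to [x] is then a
    permutation of [T], whose orbits are circuits. Such a circuit is odd, as
    the edges of an even one are linearly dependent ([orbit_odd]), and
    consecutive coordinates add up to 1 on it, so they are all 1/2. Hence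
    [v - e(C)] is still in the cone, and [v = e(C)]. *)

(** * Hilbert bases and indecomposable elements *)

Definition indecomposable (V : zmodType) (M : set V) (v : V) : Prop :=
  [/\ M v, v != 0 & forall u w, M u -> M w -> v = u + w -> u = 0 \/ w = 0].

Section HilbertBases.
Variables (R : realFieldType) (n : nat) (K : set 'rV[R]_n).
Let M := lattice_points K.
Hypothesis M0 : M 0.
Hypothesis MD : forall u w, M u -> M w -> M (u + w).

Lemma lattice_pointsMn v k : M v -> M (v *+ k).
Proof. by move=> Mv; elim: k => // k IHk; rewrite mulrS; apply: MD. Qed.

(** A combination that is equal to an indecomposable element has a nonzero
    term; split off one copy of its generator, and the rest must vanish. *)
Lemma indecomposable_in_hilbert_basis H v :
  hilbert_basis K H -> indecomposable M v -> v \in H.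
Proof.
case=> HM Hgen [Mv v0 v_ind]; have [c v_eq] := Hgen v Mv.
have /hasP[h hH hc0] : has (fun h => h *+ c h != 0) H.
  apply: contraNT v0 => /hasPn all0; rewrite v_eq big_seq big1 // => h hH.
  by apply/eqP; move: (all0 h hH); rewrite negbK.
have ch_gt0 : (0 < c h)%N by case: (c h) hc0 => //; rewrite mulr0n eqxx.
pose w := h *+ (c h).-1 + \sum_(g <- rem h H) g *+ c g.
have v_split : v = h + w.
  by rewrite v_eq (big_rem h) //= /w addrA -mulrS prednK.
have Mw : M w.
  apply: MD; first exact/lattice_pointsMn/HM.
  rewrite big_seq; apply: (big_ind M) => // g /mem_rem gH.
  exact/lattice_pointsMn/HM.
have [h0|w0] := v_ind h w (HM h hH) Mw v_split.
  by rewrite h0 mul0rn eqxx in hc0.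
by rewrite v_split w0 addr0.
Qed.

(* A positive additive height makes the decomposition process terminate. *)
Section Height.
Variable ht : 'rV[int]_n -> int.
Hypothesis htD : forall u w, ht (u + w) = ht u + ht w.
Hypothesis ht_gt0 : forall v, M v -> v != 0 -> 0 < ht v.

Lemma indecomposables_hilbert_basis (H : {fset 'rV[int]_n}) :
  (forall h, h \in H <-> indecomposable M h) -> hilbert_basis K H.
Proof.
move=> Hind; split=> [h /Hind[]//|v].
have [k] := ubnP `|ht v|%N; elim: k v => // k IHk v ltk Mv.
have [->|v0] := eqVneq v 0.
  by exists (fun=> 0%N); rewrite big1 // => h _; rewrite mulr0n.
have [v_ind|v_dec] := pselect (indecomposable M v).
  (* an indecomposable v is itself one of the generators *)
  exists (fun h => (h == v)%N : nat).
  rewrite (big_rem v) /=; last exact/Hind.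
  rewrite eqxx mulr1n big_seq big1 ?addr0 // => h.
  by rewrite mem_rem_uniq ?fset_uniq // inE => /andP[/negPf-> _]; rewrite mulr0n.
have [u [w [Mu u0 Mw w0 vE]]] : exists u w, [/\ M u, u != 0, M w, w != 0 & v = u + w].
  apply: contrapT => no_split; apply: v_dec; split=> // u w Mu Mw vE.
  have [->|u0] := eqVneq u 0; first by left.
  have [->|w0] := eqVneq w 0; first by right.
  by case: no_split; exists u, w.
have := ht_gt0 Mu u0; have := ht_gt0 Mw w0.
rewrite vE htD in ltk => htw htu.
have [|//|cu uE] := IHk u; first lia.
have [|//|cw wE] := IHk w; first lia.
exists (fun h => (cu h + cw h)%N).
by rewrite vE {1}uE {1}wE -big_split /=; apply: eq_bigr => h _; rewrite mulrnDr.
Qed.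

(** A minimal Hilbert basis contains all indecomposable elements, and those
    already form a Hilbert basis, so there is nothing else in it. *)
Lemma min_hilbert_basisP (H : {fset 'rV[int]_n}) :
  min_hilbert_basis K H <-> forall h, h \in H <-> indecomposable M h.
Proof.
split=> [[HK Hmin]|Hind]; last first.
  split=> [|H' H'K H'H]; first exact: indecomposables_hilbert_basis.
  apply/eqP; rewrite eqEfsubset H'H /=; apply/fsubsetP => h /Hind.
  exact: indecomposable_in_hilbert_basis.
pose H' := [fset h in H | `[< indecomposable M h >]]%fset.
have H'ind h : h \in H' <-> indecomposable M h.
  rewrite !inE; split=> [/andP[_ /asboolP]//|h_ind].
  by rewrite (indecomposable_in_hilbert_basis HK h_ind); apply/asboolP.
rewrite -(Hmin H') //; first exact: indecomposables_hilbert_basis.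
by apply/fsubsetP => h; rewrite !inE => /andP[].
Qed.

End Height.
End HilbertBases.

(** * Lattice points of basis cones *)

Section BasisCones.
Variables (R : realFieldType) (n : nat).
Implicit Types (B : 'M[int]_n) (v : 'rV[int]_n) (l : 'I_n -> R).

Definition cone_point B := lattice_points (@basis_cone R n B).

Definition coordinates B v l :=
  forall x, (v 0 x)%:~R = \sum_i l i * (B i x)%:~R :> R.

Lemma coordinatesE B v l :
  coordinates B v l <-> real_mx R v = \row_i l i *m real_mx R B.
Proof.
split=> [vl|vl x].
  apply/rowP => x; by rewrite !mxE vl; apply: eq_bigr => i _; rewrite !mxE.
move/rowP/(_ x): vl; rewrite !mxE => ->.
by apply: eq_bigr => i _; rewrite !mxE.
Qed.

Lemma cone_pointP B v :
  cone_point B v <-> exists2 l, forall i, 0 <= l i & coordinates B v l.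
Proof.
rewrite /cone_point /lattice_points /basis_cone /=.
split=> -[l l0 vl]; exists l => //.
  apply/coordinatesE; rewrite vl mulmx_sum_row; apply: eq_bigr => i _.
  by rewrite mxE.
move/coordinatesE: vl => ->; rewrite mulmx_sum_row; apply: eq_bigr => i _.
by rewrite mxE.
Qed.

Lemma coordinatesD B u w l m : coordinates B u l -> coordinates B w m ->
  coordinates B (u + w) (fun i => l i + m i).
Proof.
move=> ul wm x; rewrite mxE intrD ul wm -big_split /=.
by apply: eq_bigr => i _; rewrite mulrDl.
Qed.

Lemma coordinatesB B u w l m : coordinates B u l -> coordinates B w m ->
  coordinates B (u - w) (fun i => l i - m i).
Proof.
move=> ul wm x; rewrite !mxE intrB ul wm -sumrB.
by apply: eq_bigr => i _; rewrite mulrBl.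
Qed.

Lemma coordinates_row B i : coordinates B (row i B) (fun j => (j == i)%:R).
Proof.
move=> x; rewrite mxE (bigD1 i) //= eqxx mul1r big1 ?addr0 // => j /negPf->.
by rewrite mul0r.
Qed.

Lemma coordinates_inj B v l m : row_free (real_mx R B) ->
  coordinates B v l -> coordinates B v m -> l =1 m.
Proof.
move=> Bfree /coordinatesE vl /coordinatesE; rewrite vl.
by move=> /(row_free_inj Bfree)/rowP lm i; have := lm i; rewrite !mxE.
Qed.

Lemma cone_point0 B : cone_point B 0.
Proof.
apply/cone_pointP; exists (fun=> 0) => // x.
by rewrite mxE big1 // => i _; rewrite mul0r.
Qed.

Lemma cone_pointD B u w : cone_point B u -> cone_point B w -> cone_point B (u + w).
Proof.
move=> /cone_pointP[l l0 ul] /cone_pointP[m m0 wm]; apply/cone_pointP.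
exists (fun i => l i + m i); last exact: coordinatesD.
by move=> i; rewrite addr_ge0.
Qed.

Lemma det_basis_neq0 B : row_free (real_mx R B) -> \det B != 0.
Proof.
by rewrite row_free_unit unitmxE unitfE det_map_mx intr_eq0.
Qed.

(** This is [|\det B|] times the sum of the coordinates of [v] in the rows of
    [B] (see [cone_heightE]). The adjugate, unlike the inverse, keeps it
    integral, so that it can measure termination even if [R] is not
    archimedean. *)
Definition cone_height B v : int := Num.sg (\det B) * \sum_i (v *m \adj B) 0 i.

Lemma cone_heightE B v l : coordinates B v l ->
  (cone_height B v)%:~R = `|\det B|%:~R * \sum_i l i :> R.
Proof.
move=> /coordinatesE vl; rewrite normrEsg /cone_height !intrM -mulrA; congr (_ * _).
rewrite rmorph_sum mulr_sumr /=; apply: eq_bigr => i _.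
transitivity (real_mx R (v *m \adj B) 0 i); first by rewrite [RHS]mxE.
rewrite /real_mx map_mxM -/(real_mx R v) vl -mulmxA -map_mxM mul_mx_adj.
by rewrite map_scalar_mx mul_mx_scalar !mxE.
Qed.

Lemma cone_heightD B u w :
  cone_height B (u + w) = cone_height B u + cone_height B w.
Proof.
rewrite /cone_height -mulrDr -big_split mulmxDl; congr (_ * _).
by apply: eq_bigr => i _; rewrite mxE.
Qed.

Lemma cone_height_gt0 B v : row_free (real_mx R B) -> cone_point B v ->
  v != 0 -> 0 < cone_height B v.
Proof.
move=> Bfree /cone_pointP[l l0 vl] v0.
rewrite -(ltr0z R) (cone_heightE vl) mulr_gt0 //.
  by rewrite ltr0z normr_gt0 det_basis_neq0.
rewrite lt0r sumr_ge0 // andbT; apply: contra v0 => /eqP l_sum0.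
apply/eqP/rowP => x; apply/eqP; rewrite [X in _ == X]mxE -(intr_eq0 R) vl big1 // => i _.
by rewrite (psumr_eq0P _ l_sum0) ?mul0r.
Qed.

(** If the coordinate on a row is at least 1, that row can be subtracted
    without leaving the cone. *)
Lemma indecomposable_row_or_lt1 B v l : row_free (real_mx R B) ->
  indecomposable (cone_point B) v -> (forall i, 0 <= l i) -> coordinates B v l ->
  (exists i, v = row i B) \/ forall i, l i < 1.
Proof.
move=> Bfree [_ _ v_ind] l0 vl.
have [/existsP[i li]|/existsPn l1] := boolP [exists i, 1 <= l i]; last first.
  by right=> i; rewrite ltNge.
left; exists i.
have Bi : cone_point B (row i B).
  apply/cone_pointP; exists (fun j => (j == i)%:R); last exact: coordinates_row.
  by move=> j; rewrite ler0n.
have rest : cone_point B (v - row i B).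
  apply/cone_pointP; exists (fun j => l j - (j == i)%:R).
    by move=> j; case: eqP => [->|_]; rewrite subr_ge0.
  exact: coordinatesB vl (coordinates_row B i).
have [|Bi0|/eqP] := v_ind _ _ Bi rest; first by rewrite addrC subrK.
  have Bi0' : coordinates B (row i B) (fun=> 0).
    by move=> x; rewrite Bi0 mxE big1 // => j _; rewrite mul0r.
  have /eqP := coordinates_inj Bfree (coordinates_row B i) Bi0' i.
  by rewrite eqxx oner_eq0.
by rewrite subr_eq0 => /eqP.
Qed.

Lemma min_hilbert_basis_coneP B (H : {fset 'rV[int]_n}) :
  row_free (real_mx R B) -> min_hilbert_basis (@basis_cone R n B) H <->
  forall h, h \in H <-> indecomposable (cone_point B) h.
Proof.
move=> Bfree; apply: (@min_hilbert_basisP R n _ _ _ (cone_height B)).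
- exact: cone_point0.
- exact: cone_pointD.
- exact: cone_heightD.
- by move=> v; apply: cone_height_gt0.
Qed.

(** The indecomposable points are finitely many: their coordinates are at most
    1, so their entries are bounded by those of [B]. *)
Lemma min_hilbert_basis_exists B : row_free (real_mx R B) ->
  exists H, min_hilbert_basis (@basis_cone R n B) H.
Proof.
move=> Bfree; pose N := (\sum_i \sum_x `|B i x|)%N.
have bound v : indecomposable (cone_point B) v -> forall x, (`|v 0%R x| <= N)%N.
  move=> v_ind x; have [/cone_pointP[l l0 vl] _ _] := v_ind.
  have rowN : (\sum_i `|B i x| <= N)%N.
    by apply: leq_sum => i _; rewrite (bigD1 x) //= leq_addr.
  apply: leq_trans rowN.
  have [[i ->]|l1] := indecomposable_row_or_lt1 Bfree v_ind l0 vl.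
    by rewrite mxE (bigD1 i) //= leq_addr.
  rewrite -(ler_nat R) !natr_absz intr_norm vl natr_sum.
  apply: le_trans (ler_norm_sum _ _ _) _; apply: ler_sum => i _.
  rewrite natr_absz intr_norm normrM ger0_norm //.
  by rewrite ler_piMl // ltW.
pose box := [seq (\row_x ((f x : nat)%:Z - N%:Z) : 'rV[int]_n) |
             f : {ffun 'I_n -> 'I_(2 * N).+1}].
exists [fset v in box | `[< indecomposable (cone_point B) v >]]%fset.
apply/(min_hilbert_basis_coneP _ Bfree) => v; rewrite !inE /=.
split=> [/andP[_ /asboolP]//|v_ind].
apply/andP; split; last exact/asboolP.
apply/mapP; exists [ffun x => inord `|(v 0 x + N%:Z)%R|%N]; rewrite ?mem_enum //.
have shift (z : int) : (`|z| <= N)%N ->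
    z = `|(z + N%:Z)%R|%N%:Z - N%:Z /\ (`|(z + N%:Z)%R| < (2 * N).+1)%N.
  by clear; lia.
apply/rowP => x; have [] := shift _ (bound v v_ind x).
by rewrite mxE ffunE => zE ltz; rewrite inordK.
Qed.

Lemma hilbert_stepP (A : set 'rV[int]_n) v : hilbert_step R A v <->
  exists2 B, basis_in R A B & indecomposable (cone_point B) v.
Proof.
split=> [[B [H [[AB Bfree] Hmin vH]]]|[B [AB Bfree] v_ind]].
  exists B => //.
  by case: (min_hilbert_basis_coneP H Bfree) => /(_ Hmin)/(_ v)[/(_ vH)].
have [H Hmin] := min_hilbert_basis_exists Bfree.
exists B, H; split=> //.
by case: (min_hilbert_basis_coneP H Bfree) => /(_ Hmin)/(_ v)[_ /(_ v_ind)].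
Qed.

End BasisCones.

(** * Cyclic sequences *)

Section CyclicSequences.
Variables (T : finType) (c : seq T).
Hypothesis c_uniq : uniq c.

Lemma next_inj : injective (next c).
Proof. exact: can_inj (prev_next c_uniq). Qed.

Lemma sum_next (V : nmodType) (F : T -> V) :
  \sum_(x in c) F (next c x) = \sum_(x in c) F x.
Proof.
rewrite [RHS](reindex_inj next_inj) /=; apply: eq_bigl => x.
by rewrite mem_next.
Qed.

Lemma iter_next_size x : x \in c -> iter (size c) (next c) x = x.
Proof.
move=> xc; have c_next := cycle_next c_uniq.
by rewrite -{1}(order_cycle c_next c_uniq xc) (iter_order_cycle c_next).
Qed.

Lemma iter_next_in k x : x \in c -> iter k (next c) x \in c.
Proof. by move=> xc; elim: k => //= k; rewrite mem_next. Qed.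

Lemma iter_next_twist (U : Type) (g : T -> U) (phi : U -> U) k x :
  {in c, forall y, g (next c y) = phi (g y)} -> x \in c ->
  g (iter k (next c) x) = iter k phi (g x).
Proof.
by move=> g_phi xc; elim: k => //= k <-; rewrite g_phi ?iter_next_in.
Qed.

(** Going once around an odd cycle applies [phi] an odd number of times, and
    returns to the same value. *)
Lemma odd_cycle_fixed (U : Type) (g : T -> U) (phi : U -> U) x :
  odd (size c) -> involutive phi ->
  {in c, forall y, g (next c y) = phi (g y)} -> x \in c -> phi (g x) = g x.
Proof.
move=> c_odd phiK g_phi xc; rewrite -{2}(iter_next_size xc).
rewrite (iter_next_twist _ g_phi xc) -(odd_double_half (size c)) c_odd /=.
by elim: _./2 => //= k IHk; rewrite phiK.
Qed.

Lemma next_invariant (U : Type) (g : T -> U) x y :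
  {in c, forall z, g (next c z) = g z} -> x \in c -> y \in c -> g x = g y.
Proof.
move=> g_inv xc; rewrite -(fconnect_cycle (cycle_next c_uniq) xc).
move/iter_findex <-.
rewrite (@iter_next_twist _ g id) //; by elim: (findex _ _ _).
Qed.

End CyclicSequences.

(** * The basis cone of an odd circuit *)

Section UnitVectors.
Variable n : nat.

Lemma unit_vecE (i x : 'I_n) : unit_vec i 0 x = (x == i)%:R.
Proof. by rewrite mxE eqxx. Qed.

Lemma circuit_vecE (c : seq 'I_n) x : circuit_vec c 0 x = (x \in c)%:R.
Proof.
rewrite summxE (eq_bigr (fun i => (x == i)%:R)) => [|i _]; last exact: unit_vecE.
have [xc|xc] := boolP (x \in c).
  rewrite (bigD1 x) ?inE //= eqxx big1 ?addr0 // => i /andP[_].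
  by rewrite eq_sym => /negPf->.
rewrite big1 // => i; rewrite inE; case: eqP => // <- xc'.
by rewrite xc' in xc.
Qed.

Lemma char_vec_pair (x y : 'I_n) : x != y ->
  char_vec [set x; y]%SET = unit_vec x + unit_vec y.
Proof. by move=> xy; rewrite /char_vec big_setU1 ?big_set1 ?inE. Qed.

End UnitVectors.

Section CircuitBasis.
Variables (R : realFieldType) (n : nat) (c : seq 'I_n).
Hypothesis c_uniq : uniq c.
Hypothesis c_odd : odd (size c).

(** Indexing each edge of the circuit by its first vertex, and [- e_i] by [i],
    gives a square matrix. *)
Definition circuit_basis : 'M[int]_n :=
  \matrix_i (if i \in c then unit_vec i + unit_vec (next c i) else - unit_vec i).

(** Column [x], for [x] in [c], is nonzero only in the rows of [x] and of its
    predecessor. *)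
Lemma circuit_basis_sum (l : 'I_n -> R) x :
  \sum_i l i * (circuit_basis i x)%:~R =
  if x \in c then l x + l (prev c x) else - l x.
Proof.
have BE i : l i * (circuit_basis i x)%:~R =
    (if i == x then if x \in c then l x else - l x else 0) +
    (if i == prev c x then if x \in c then l i else 0 else 0).
  have -> : (i == prev c x) = (next c i == x).
    by rewrite eq_sym (can2_eq (next_prev c_uniq) (prev_next c_uniq)) eq_sym.
  have xi : i == x -> (x \in c) = (i \in c) by move/eqP->.
  have xn : next c i == x -> (x \in c) = (i \in c).
    by move/eqP <-; rewrite mem_next.
  rewrite mxE; case: ifP xi xn => ic; rewrite !mxE !eqxx /= !(eq_sym x).
    by case: (i =P x) => [<- /(_ isT) -> _|_ _];
      [case: (next c i == i)|case: (next c i == x) => [/(_ isT) ->|_]] => /=; ring.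
  by case: (i =P x) => [<- /(_ isT) -> _|_ _];
      [case: (next c i == i)|case: (next c i == x) => [/(_ isT) ->|_]] => /=; ring.
rewrite (eq_bigr _ (fun i _ => BE i)) big_split /= -!big_mkcond !big_pred1_eq.
by case: ifP; rewrite ?addr0.
Qed.

(** In a linear dependence, the coefficients of consecutive edges are opposite;
    as the circuit is odd, each of them is its own opposite. *)
Lemma circuit_basis_free : row_free (real_mx R circuit_basis).
Proof.
apply: inj_row_free => u uB.
have uE x : (if x \in c then u 0 x + u 0 (prev c x) else - u 0 x) = 0.
  rewrite -circuit_basis_sum; move/rowP/(_ x): uB; rewrite mxE [X in _ = X]mxE.
  by move=> uBx; rewrite -[RHS]uBx; apply: eq_bigr => i _; rewrite [real_mx _ _ _ _]mxE.
apply/rowP => x; rewrite mxE; have [xc|xc] := boolP (x \in c); last first.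
  by have /eqP := uE x; rewrite (negPf xc) oppr_eq0 => /eqP.
suff : - u 0 x = u 0 x by lra.
apply: (@odd_cycle_fixed _ c c_uniq R (u 0) -%R x c_odd (@opprK R) _ xc) => y yc.
have := uE (next c y).
by rewrite mem_next yc prev_next // => /eqP; rewrite addr_eq0 => /eqP.
Qed.

Lemma circuit_vec_coordinates :
  coordinates circuit_basis (circuit_vec c) (fun i => (i \in c)%:R / 2 : R).
Proof.
move=> x; rewrite circuit_basis_sum circuit_vecE mem_prev.
case: (x \in c) => /=; lra.
Qed.

(** If [e(c) = u + w] in the cone, the coordinates of [u] and [w] on each edge
    add up to 1/2. Integrality of [u] at a vertex forces the coordinates of [u]
    on the two edges there to be both 0 or both 1/2, and this choice propagates
    around the circuit. *)
Lemma circuit_vec_indecomposable :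
  indecomposable (cone_point R circuit_basis) (circuit_vec c).
Proof.
have c_neq0 : circuit_vec c != 0.
  case: c c_odd => // x c' _; apply/negP => /eqP/rowP/(_ x).
  by rewrite circuit_vecE mem_head mxE.
split=> //.
  apply/cone_pointP; exists (fun i => (i \in c)%:R / 2).
    by move=> i; rewrite divr_ge0.
  exact: circuit_vec_coordinates.
move=> u w /cone_pointP[l l0 ul] /cone_pointP[m m0 wm] cE.
have lm i : l i + m i = (i \in c)%:R / 2.
  have cl := coordinatesD ul wm; rewrite -cE in cl.
  exact: coordinates_inj circuit_basis_free cl circuit_vec_coordinates i.
have l_out i : i \notin c -> l i = 0 /\ m i = 0.
  move=> ic; have := lm i; rewrite (negPf ic) /=.
  by have := l0 i; have := m0 i; split; lra.
have l_step : {in c, forall y, (l y = 0 \/ l y = 1 / 2) /\ l (next c y) = l y}.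
  move=> y yc; have := ul (next c y).
  rewrite circuit_basis_sum mem_next yc prev_next // => uy.
  have := lm y; have := lm (next c y); rewrite mem_next yc /= => lmy lmny.
  have := l0 y; have := l0 (next c y); have := m0 y; have := m0 (next c y).
  move=> my mny ly lny.
  have z_ge0 : 0 <= u 0 (next c y) by rewrite -(ler0z R); lra.
  have z_le1 : u 0 (next c y) <= 1 by rewrite -(lerz1 R); lra.
  have [z0|z1] : u 0 (next c y) = 0 \/ u 0 (next c y) = 1 by lia.
    by move: uy; rewrite z0 => uy; split; [left|]; lra.
  by move: uy; rewrite z1 => uy; split; [right|]; lra.
have l_const x y : x \in c -> y \in c -> l x = l y.
  by apply: next_invariant => // z zc; case: (l_step z zc).
have [x xc] : exists x, x \in c by case: c c_odd => // x c' _; exists x; rewrite mem_head.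
have [[lx|lx] _] := l_step x xc; [left|right]; apply/rowP => y; apply/eqP;
  rewrite [X in _ == X]mxE -(intr_eq0 R) ?ul ?wm big1 // => i _.
  have [ic|/l_out[-> _]] := boolP (i \in c); last by rewrite mul0r.
  by rewrite (l_const i x) // lx mul0r.
have [ic|/l_out[_ ->]] := boolP (i \in c); last by rewrite mul0r.
have := lm i; rewrite ic /= (l_const i x) // lx => mi.
have -> : m i = 0 by lra.
by rewrite mul0r.
Qed.

End CircuitBasis.

(** * Indecomposable points in the basis cones of a graph *)

(** With [a], [b] the number of incidences counted by rows and by columns, one
    has [2 #|T| <= b = a <= 2 #|S| <= 2 #|T|], the last step by the injection
    [s]; so everything is tight. *)
Lemma tight_incidence (I X : finType) (inc : I -> X -> bool) (S : {set I})
    (s : I -> X) (T := [set x | [exists i in S, inc i x]]%SET) :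
  {in S &, injective s} -> {in S, forall i, inc i (s i)} ->
  {in S, forall i, #|[set x | inc i x]%SET| <= 2}%N ->
  {in T, forall x, 2 <= #|[set i in S | inc i x]%SET|}%N ->
  [/\ s @: S = T, {in S, forall i, #|[set x | inc i x]%SET| = 2%N} &
      {in T, forall x, #|[set i in S | inc i x]%SET| = 2%N}].
Proof.
move=> s_inj inc_s deg_row deg_col.
have sST : s @: S \subset T.
  apply/fintype.subsetP => _ /imsetP[i iS ->]; rewrite inE; apply/existsP; exists i.
  by rewrite iS inc_s.
have leST : (#|S| <= #|T|)%N by rewrite -(card_in_imset s_inj) subset_leq_card.
have row_sum : (\sum_(i in S) #|[set x | inc i x]%SET| <= \sum_(i in S) 2
    ?= iff [forall (i | i \in S), #|[set x | inc i x]%SET| == 2])%N.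
  by apply: leqif_sum => i iS; exact: leqif_eq (deg_row i iS).
have col_sum : (\sum_(x in T) 2 <= \sum_(x in T) #|[set i in S | inc i x]%SET|
    ?= iff [forall (x | x \in T), 2 == #|[set i in S | inc i x]%SET|])%N.
  by apply: leqif_sum => x xT; exact: leqif_eq (deg_col x xT).
have double_count : (\sum_(i in S) #|[set x | inc i x]%SET| =
                     \sum_(x in T) #|[set i in S | inc i x]%SET|)%N.
  transitivity (\sum_(i in S) \sum_(x in T) inc i x)%N.
    apply: eq_bigr => i iS; rewrite -sum1dep_card big_mkcond /=.
    rewrite [RHS]big_mkcond /=; apply: eq_bigr => x _; rewrite inE.
    case: ifP => incx; last by case: ifP.
    by rewrite ifT //; apply/existsP; exists i; rewrite iS.
  rewrite exchange_big; apply: eq_bigr => x _.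
  by rewrite -sum1dep_card big_mkcondr; apply: eq_bigr => i _; case: (inc i x).
move: row_sum col_sum; rewrite !sum_nat_const double_count.
move=> [row_le row_eq] [col_le col_eq].
have row_tight : (\sum_(x in T) #|[set i in S | inc i x]%SET| = #|S| * 2)%N by lia.
have col_tight : (\sum_(x in T) #|[set i in S | inc i x]%SET| = #|T| * 2)%N by lia.
split.
- by apply/eqP; rewrite eqEcard sST card_in_imset //; lia.
- move: row_eq; rewrite row_tight eqxx => /esym/forall_inP row2 i iS.
  exact/eqP/row2.
- move: col_eq; rewrite col_tight eqxx => /esym/forall_inP col2 x xT.
  exact/esym/eqP/col2.
Qed.

(** Some term of the Leibniz expansion of the determinant is nonzero. *)
Lemma nonsingular_transversal (R : realFieldType) n (B : 'M[int]_n) :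
  row_free (real_mx R B) -> exists s : {perm 'I_n}, forall i, B i (s i) != 0.
Proof.
move=> /det_basis_neq0 detB.
have [/existsP[s /forallP sB]|/existsPn noB] :=
  boolP [exists s : {perm 'I_n}, [forall i, B i (s i) != 0]]; first by exists s.
case/eqP: detB; rewrite /determinant big1 // => s _.
have /forallPn[i] := noB s; rewrite negbK => /eqP Bi.
by rewrite (bigD1 i) //= Bi mul0r mulr0.
Qed.

Section GraphCones.
Variables (R : realFieldType) (n : nat) (e : rel 'I_n).
Hypotheses (e_sym : symmetric e) (e_irr : irreflexive e).

Lemma edge_neq x y : e x y -> x != y.
Proof. by apply: contraTneq => ->; rewrite e_irr. Qed.

Lemma graph_vectors_norm_le1 g x : graph_vectors e g -> `|g 0 x| <= 1.
Proof.
case=> [[a [b [eab ->]]]|[a ->]]; rewrite !mxE !eqxx /=.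
  have := edge_neq eab; case: (x =P a) => [->|_]; last by case: (x == b).
  by move=> /negPf->.
by case: (x == a).
Qed.

Lemma graph_vectors_support g : graph_vectors e g ->
  (#|[set x | g 0%R x != 0]%SET| <= 2)%N.
Proof.
case=> [[a [b [eab ->]]]|[a ->]].
  apply: leq_trans (_ : #|[set a; b]%SET| <= 2)%N; last first.
    by rewrite cards2; case: (a != b).
  apply/subset_leq_card/fintype.subsetP => x; rewrite !inE !mxE !eqxx /=.
  by case: (x == a); case: (x == b).
apply: leq_trans (_ : #|[set a]%SET| <= 2)%N; last by rewrite cards1.
apply/subset_leq_card/fintype.subsetP => x; rewrite !inE !mxE !eqxx /=.
by case: (x == a).
Qed.

Lemma graph_vectors_edge g x : graph_vectors e g ->
  #|[set y | g 0%R y != 0]%SET| = 2%N -> g 0 x != 0 ->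
  exists2 y, e x y & g = unit_vec x + unit_vec y.
Proof.
case=> [[a [b [eab ->]]] _|[a ->]]; last first.
  suff -> : [set y | (- unit_vec a) 0%R y != 0]%SET = [set a]%SET.
    by rewrite cards1.
  by apply/setP => y; rewrite !inE !mxE eqxx /=; case: (y == a).
rewrite !mxE !eqxx /=; have [-> _|_] := eqVneq x a; first by exists b.
have [-> _|//] := eqVneq x b; by exists a; rewrite 1?e_sym // addrC.
Qed.

Variable B : 'M[int]_n.
Hypothesis B_graph : forall i, graph_vectors e (row i B).
Hypothesis B_free : row_free (real_mx R B).

Section SmallCoordinates.
Variables (v : 'rV[int]_n) (l : 'I_n -> R).
Hypothesis l_ge0 : forall i, 0 <= l i.
Hypothesis l_lt1 : forall i, l i < 1.
Hypothesis vl : coordinates B v l.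

(** If [i] were the only row in the support that touches [x], the entry
    [v 0 x] would be [l i] up to sign, which is not an integer. *)
Lemma fractional_degree_ge2 i x : 0 < l i -> B i x != 0 ->
  (2 <= #|[set j in [set j | (0 < l j)%R]%SET | B j x != 0]%SET|)%N.
Proof.
move=> li Bix; set J := [set j in _ | _]%SET.
have iJ : i \in J by rewrite !inE li.
rewrite (cardsD1 i) iJ ltnS card_gt0; apply/negP => /eqP J1.
have vx : (v 0 x)%:~R = l i * (B i x)%:~R :> R.
  rewrite vl (bigD1 i) //= big1 ?addr0 // => j ji.
  have /finset.setP/(_ j) := J1; rewrite !inE ji /= => /negbT.
  rewrite negb_and negbK lt0r l_ge0 andbT negbK.
  by case/orP => /eqP->; rewrite ?mul0r ?mulr0.
have Bi1 : `|B i x| = 1.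
  by have := graph_vectors_norm_le1 x (B_graph i); rewrite mxE; lia.
have : `|v 0 x|%:~R = l i :> R.
  by rewrite intr_norm vx normrM -intr_norm Bi1 mulr1 ger0_norm.
move=> normv; have := l_lt1 i; rewrite -normv (ltrz1 R) => v1.
by move: li; rewrite -normv ltr0z; lia.
Qed.

Let S := [set i | 0 < l i]%SET.
Let T := [set x | [exists i in S, B i x != 0]]%SET.

(** The perfect matching [s] between rows and vertices orients every edge of
    the support: the edge assigned to [x] leads from [x] to [f x]. The last
    clause says that the only edges at [f x] are this one and the one assigned
    to [f x]. *)
Lemma fractional_rows_two_regular : exists (s : {perm 'I_n}) (f : 'I_n -> 'I_n),
  [/\ {in S, forall i, s i \in T},
      {in T, forall x, [/\ (s^-1)%g x \in S, e x (f x), f x \in T &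
                          row ((s^-1)%g x) B = unit_vec x + unit_vec (f x)]} &
      {in T, forall x, forall j, j \in S -> B j (f x) != 0 ->
                          j = (s^-1)%g x \/ j = (s^-1)%g (f x)}].
Proof.
have [s sB] := nonsingular_transversal B_free.
have [] := @tight_incidence _ _ (fun i x => B i x != 0) S s.
- by move=> i j _ _; apply: perm_inj.
- by move=> i _; apply: sB.
- move=> i _; have := graph_vectors_support (B_graph i).
  by rewrite (eq_card (B := [set x | B i x != 0]%SET)) // => x; rewrite !inE mxE.
- move=> x; rewrite inE => /existsP[i /andP[iS Bix]].
  by apply: fractional_degree_ge2 Bix; rewrite inE in iS.
rewrite -/T => sST row2 col2.
have inS x : x \in T -> (s^-1)%g x \in S.
  by rewrite -sST => /imsetP[i iS ->]; rewrite permK.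
have /fin_all_exists[f fP] (x : 'I_n) : exists y, x \in T ->
    e x y /\ row ((s^-1)%g x) B = unit_vec x + unit_vec y.
  have [xT|_] := boolP (x \in T); last by exists x.
  have [|||y exy rowE] := @graph_vectors_edge (row ((s^-1)%g x) B) x.
  - exact: B_graph.
  - by rewrite -(row2 _ (inS x xT)); apply: eq_card => y; rewrite !inE mxE.
  - by have := sB ((s^-1)%g x); rewrite permKV mxE.
  by exists y.
have fT x : x \in T -> f x \in T.
  move=> xT; have [exf rowE] := fP x xT.
  rewrite inE; apply/existsP; exists ((s^-1)%g x); rewrite inS //=.
  have -> : B ((s^-1)%g x) (f x) = row ((s^-1)%g x) B 0 (f x) by rewrite mxE.
  by rewrite rowE !mxE !eqxx /=; case: (f x == x).
exists s, f; split.
- by move=> i iS; rewrite -sST imset_f.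
- by move=> x xT; have [exf rowE] := fP x xT; rewrite inS // fT.
move=> x xT j jS Bjf; have [exf rowE] := fP x xT.
have rx_ry : (s^-1)%g x != (s^-1)%g (f x).
  by rewrite (inj_eq perm_inj) edge_neq.
suff : j \in [set (s^-1)%g x; (s^-1)%g (f x)]%SET.
  by rewrite !inE => /orP[]/eqP; [left|right].
suff -> : [set (s^-1)%g x; (s^-1)%g (f x)]%SET = [set i in S | B i (f x) != 0]%SET.
  by rewrite inE jS.
apply/eqP; rewrite eqEcard cards2 rx_ry (col2 _ (fT x xT)) andbT.
apply/fintype.subsetP => i; rewrite in_set2 finset.in_set => /orP[]/eqP->.
  rewrite inS //=.
  have -> : B ((s^-1)%g x) (f x) = row ((s^-1)%g x) B 0 (f x) by rewrite mxE.
  by rewrite rowE !mxE !eqxx /=; case: (f x == x).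
by rewrite inS ?fT //=; have := sB ((s^-1)%g (f x)); rewrite permKV.
Qed.

Section AlongOrbit.
Variables (s : {perm 'I_n}) (f : 'I_n -> 'I_n).
Let r x := (s^-1)%g x.
Hypothesis f_edge : {in T, forall x,
  [/\ r x \in S, e x (f x), f x \in T & row (r x) B = unit_vec x + unit_vec (f x)]}.
Hypothesis f_rows : {in T, forall x, forall j, j \in S -> B j (f x) != 0 ->
  j = r x \/ j = r (f x)}.

Let r_inj : injective r.
Proof. exact: perm_inj. Qed.

Lemma row_atE x y : x \in T -> B (r x) y = (y == x)%:R + (y == f x)%:R.
Proof.
move=> xT; have [_ _ _ /rowP/(_ y)] := f_edge xT.
by rewrite !mxE !eqxx.
Qed.

Lemma row_atR x y : x \in T ->
  (B (r x) y)%:~R = (y == x)%:R + (y == f x)%:R :> R.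
Proof. by move=> xT; rewrite row_atE // intrD; case: (y == x); case: (y == f x). Qed.

Lemma successor_in x : x \in T -> f x \in T.
Proof. by case/f_edge. Qed.

(** Two vertices with the same successor would have their edges, and the edge
    assigned to the successor, meeting at one vertex of degree two. *)
Lemma successor_inj : {in T &, injective f}.
Proof.
move=> x y xT yT fxy; have [rxS exf fxT _] := f_edge xT.
have [] := f_rows yT rxS.
- by rewrite -fxy row_atE // eqxx; case: (f x == x).
- by move/r_inj.
- by rewrite -fxy => /r_inj xf; rewrite -xf e_irr in exf.
Qed.

(** The two coordinates are those of the edges at [f x]; their sum is an entry
    of [v], hence an integer, and it lies in ]0, 2[. *)
Lemma coordinates_along_edge x : x \in T -> l (r x) + l (r (f x)) = 1.
Proof.
move=> xT; have [rxS exf fxT _] := f_edge xT; have [rfS eff _ _] := f_edge fxT.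
have rxf : r (f x) != r x.
  by rewrite (inj_eq r_inj) eq_sym edge_neq.
have vE : (v 0 (f x))%:~R = l (r x) + l (r (f x)).
  rewrite vl (bigD1 (r x)) //= (bigD1 (r (f x))) //= big1 ?addr0.
    rewrite !row_atE // eqxx (negPf (edge_neq eff)) addr0.
    by rewrite eq_sym (negPf (edge_neq exf)) add0r !mulr1.
  move=> j /andP[jx jf]; have [jS|] := boolP (j \in S).
    have [->|Bj] := eqVneq (B j (f x)) 0; first by rewrite mulr0.
    by case: (f_rows xT jS Bj) => /eqP; rewrite ?(negPf jx) ?(negPf jf).
  rewrite inE lt0r l_ge0 andbT negbK => /eqP->.
  by rewrite mul0r.
have lx : 0 < l (r x) by move: rxS; rewrite inE.
have lf : 0 < l (r (f x)) by move: rfS; rewrite inE.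
have := l_lt1 (r x); have := l_lt1 (r (f x)) => lf1 lx1.
have v_gt0 : 0 < v 0 (f x) by rewrite -(ltr0z R) vE addr_gt0.
have v_lt2 : v 0 (f x) < 2 by rewrite -(ltr_int R) vE; lra.
by rewrite -vE; have -> : v 0 (f x) = 1 by lia.
Qed.

Variable x0 : 'I_n.
Hypothesis x0T : x0 \in T.
Let c := orbit f x0.

Lemma orbit_in x : x \in c -> x \in T.
Proof.
case/trajectP => k _ ->; elim: k => //= k; exact: successor_in.
Qed.

Lemma orbit_cycle : fcycle f c.
Proof. exact: cycle_orbit_in successor_in successor_inj _ x0T. Qed.

Lemma next_orbit x : x \in c -> next c x = f x.
Proof. exact: nextE orbit_cycle _. Qed.

(** The alternating sum of the edges of a closed walk telescopes to 0 if the
    walk is even, which contradicts linear independence. *)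
Lemma orbit_odd : odd (size c).
Proof.
rewrite size_orbit; apply: contraT => m_even; set m := fingraph.order f x0 in m_even.
pose x k := iter k f x0.
have xT k : x k \in T by elim: k => //= k; apply: successor_in.
pose a i : R := \sum_(0 <= k < m) (-1) ^+ k * (i == r (x k))%:R.
(* a holds the coefficients of the alternating sum of the edges of the orbit *)
have a0 : coordinates B 0 a.
  move=> y; rewrite mxE; under eq_bigr do rewrite mulr_suml.
  rewrite exchange_big /=.
  transitivity (\sum_(0 <= k < m)
      (- ((-1) ^+ k.+1 * (y == x k.+1)%:R) - - ((-1) ^+ k * (y == x k)%:R)) : R).
    rewrite telescope_sumr // /x (iter_order_in successor_in successor_inj x0T).
    by rewrite -signr_odd (negPf m_even) /= subrr.
  apply: eq_bigr => k _; rewrite (bigD1 (r (x k))) //= big1 => [|i /negPf->].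
    by rewrite addr0 eqxx row_atR // exprS /=; ring.
  by rewrite mulr0 mul0r.
have z0 : coordinates B 0 (fun=> 0 : R).
  by move=> y; rewrite mxE big1 // => i _; rewrite mul0r.
have /eqP := coordinates_inj B_free a0 z0 (r x0).
rewrite /a big_ltn ?fingraph.order_gt0 // -[x 0%N]/x0 eqxx mulr1.
rewrite big_nat big1 ?addr0 ?oner_eq0 //.
move=> k /andP[k_gt0 k_lt]; rewrite (inj_eq r_inj) -(findex_eq0 f) findex_iter //.
by rewrite eqn0Ngt k_gt0 mulr0.
Qed.

Lemma orbit_odd_circuit : odd_circuit e c.
Proof.
rewrite /odd_circuit orbit_odd andbT; apply/and4P; split.
- by rewrite -size_eq0 size_orbit -lt0n fingraph.order_gt0.
- apply: cycle_from_next; first exact: orbit_uniq.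
  by move=> x xc; rewrite next_orbit //; case: (f_edge (orbit_in xc)).
- exact: orbit_uniq.
rewrite map_inj_in_uniq ?orbit_uniq // => x y xc yc; rewrite !next_orbit //.
have [_ exf _ rowx] := f_edge (orbit_in xc).
have [_ eyf _ rowy] := f_edge (orbit_in yc).
move=> edges_eq; apply: r_inj; apply/eqP.
have : row (r x) B = row (r y) B.
  by rewrite rowx rowy -!char_vec_pair ?edge_neq // edges_eq.
move=> row_eq; have := coordinates_row R B (r x); rewrite row_eq => rx.
have /eqP := coordinates_inj B_free rx (coordinates_row R B (r y)) (r x).
by rewrite eqxx; case: (r x == r y) => //; rewrite oner_eq0.
Qed.

Lemma orbit_coordinates_half x : x \in c -> l (r x) = 1 / 2.
Proof.
move=> xc; suff : 1 - l (r x) = l (r x) by lra.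
apply: (@odd_cycle_fixed _ c (orbit_uniq f x0) R (l \o r) (fun t => 1 - t)) => //.
- exact: orbit_odd.
- by move=> t; rewrite /=; ring.
move=> y yc /=; rewrite next_orbit //.
by have := coordinates_along_edge (orbit_in yc); lra.
Qed.

Lemma orbit_coordinates :
  coordinates B (circuit_vec c) (fun i => (s i \in c)%:R / 2 : R).
Proof.
move=> y; rewrite (reindex_inj r_inj) /=.
transitivity (\sum_(x in c) ((y == x)%:R + (y == next c x)%:R) / 2 : R); last first.
  rewrite big_mkcond; apply: eq_bigr => x _; rewrite permKV.
  case: ifP => [xc|_]; last by rewrite !mul0r.
  by rewrite next_orbit // row_atR ?orbit_in // mul1r mulrC.
rewrite -mulr_suml big_split /= (sum_next (orbit_uniq f x0) (fun z => (y == z)%:R)).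
have -> : \sum_(x in c) (y == x)%:R = (circuit_vec c 0 y)%:~R :> R.
  rewrite circuit_vecE; have [yc|yc] := boolP (y \in c).
    rewrite (bigD1 y) //= eqxx big1 ?addr0 // => x /andP[_].
    by rewrite eq_sym => /negPf->.
  by rewrite big1 // => x xc; case: eqP => // yx; rewrite yx xc in yc.
by field.
Qed.

End AlongOrbit.

(** Removing the half-sum of the edges of one circuit from [v] sets the
    corresponding coordinates to 0 and keeps the other ones, so the difference
    stays in the cone and has to vanish. *)
Lemma fractional_indecomposable_circuit :
  indecomposable (cone_point R B) v ->
  exists2 C, odd_circuit e C & circuit_vec C = v.
Proof.
case=> _ v0 v_ind.
have [s [f [s_inT f_edge f_rows]]] := fractional_rows_two_regular.
have [i iS] : exists i, i \in S.
  apply: contrapT => noS; case/eqP: v0; apply/rowP => x.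
  apply/eqP; rewrite [X in _ == X]mxE -(intr_eq0 R) vl big1 // => i _.
  have [->|li] := eqVneq (l i) 0; first by rewrite mul0r.
  by case: noS; exists i; rewrite inE lt0r li l_ge0.
have x0T := s_inT i iS; pose c := orbit f (s i).
have c_coords := orbit_coordinates f_edge f_rows x0T.
have c_odd := orbit_odd_circuit f_edge f_rows x0T.
exists c => //.
have c_neq0 : circuit_vec c != 0.
  apply/eqP => /rowP/(_ (s i)); rewrite circuit_vecE mxE.
  by rewrite /c in_orbit.
have c_cone : cone_point R B (circuit_vec c).
  apply/cone_pointP; eexists; last exact: c_coords.
  by move=> j; rewrite divr_ge0.
have rest : cone_point R B (v - circuit_vec c).
  apply/cone_pointP; eexists; last exact: (coordinatesB vl c_coords).
  move=> j /=; have [jc|_] := boolP (s j \in _); last by rewrite mul0r subr0.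
  have := orbit_coordinates_half f_edge f_rows x0T jc; rewrite permK => ->.
  by rewrite subrr.
have [|/eqP|/eqP] := v_ind _ _ c_cone rest; first by rewrite addrC subrK.
  by rewrite (negPf c_neq0).
by rewrite subr_eq0 => /eqP.
Qed.

End SmallCoordinates.

Lemma indecomposable_graph_vector_or_circuit v :
  indecomposable (cone_point R B) v ->
  graph_vectors e v \/ exists2 C, odd_circuit e C & circuit_vec C = v.
Proof.
move=> v_ind; have [/cone_pointP[l l0 vl] _ _] := v_ind.
have [[i ->]|l1] := indecomposable_row_or_lt1 B_free v_ind l0 vl.
  by left; apply: B_graph.
by right; apply: fractional_indecomposable_circuit vl v_ind.
Qed.

End GraphCones.

(** * The first Hilbert step *)

Lemma circuit_basis_graph n (e : rel 'I_n) C : circuit e C ->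
  forall i, graph_vectors e (row i (circuit_basis C)).
Proof.
case/and4P => _ C_cycle _ _ i; rewrite rowK; case: ifP => iC; last by right; exists i.
by left; exists i, (next C i); rewrite next_cycle.
Qed.

(** The entries add up to [size C] in the circuit vector, and to 2 or -1 in the
    vectors of the graph. *)
Lemma odd_circuit_not_graph_vector n (e : rel 'I_n) (C : seq 'I_n) :
  uniq C -> odd (size C) -> ~ graph_vectors e (circuit_vec C).
Proof.
move=> C_uniq C_odd.
have unit_sum (i : 'I_n) : \sum_x unit_vec i 0 x = 1.
  rewrite (bigD1 i) //= unit_vecE eqxx big1 ?addr0 // => x /negPf xi.
  by rewrite unit_vecE xi.
have C_sum : \sum_x circuit_vec C 0 x = (size C)%:Z.
  under eq_bigr do rewrite circuit_vecE.
  rewrite -(card_uniqP C_uniq) -natz -sum1_card natr_sum [RHS]big_mkcond /=.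
  by apply: eq_bigr => x _; case: (x \in C).
case=> [[i [j [_ CE]]]|[i CE]]; move: C_sum; rewrite CE.
  under eq_bigr do rewrite mxE.
  rewrite big_split /= !unit_sum; lia.
under eq_bigr do rewrite mxE.
rewrite sumrN unit_sum; lia.
Qed.

Theorem proposition4p1 (R : realFieldType) (n : nat) (e : rel 'I_n)
    (e_sym : symmetric e) (e_irr : irreflexive e) :
  iterated_vectors R e 1 `\` iterated_vectors R e 0 =
  [set circuit_vec C | C in [set C : seq 'I_n | odd_circuit e C]].
Proof.
rewrite /iterated_vectors /=; apply/seteqP; split=> [v [/hilbert_stepP]|_ [C /= CC <-]].
  move=> [B [B_graph B_free] v_ind] v_notin.
  have [//|[C CC <-]] :=
    indecomposable_graph_vector_or_circuit e_sym e_irr B_graph B_free v_ind.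
  by exists C.
have [/and4P[_ _ C_uniq _] C_odd] := andP CC.
split; last exact: odd_circuit_not_graph_vector.
apply/hilbert_stepP; exists (circuit_basis C); last exact: circuit_vec_indecomposable.
split; last exact: circuit_basis_free.
by apply: circuit_basis_graph; case/andP: CC.
Qed.
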